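(* Let $m>k\ge1$, let $F:\mathbb{R}^m\to\mathbb{R}^k$ be $C^1$, and let $p^*\in\mathbb{R}^m$ satisfy $F(p^* )=0$. Let $A_1$ be an $m\times(m-k)$ matrix and let $A_2$ be an $m\times k$ matrix. Let $X=\prod_{i=1}^{m-k}[a_i,b_i]\subset\mathbb{R}^{m-k}$, $Y=\prod_{i=1}^{k}[c_i,d_i]\subset\mathbb{R}^k$, $\mathrm{x}_0\in X$, $\mathrm{y}_0\in Y$, and set $$F_{\mathrm{x}_0,\mathrm{y}_0}:=F(p^*+A_1\mathrm{x}_0+A_2\mathrm{y}_0),$$ $$DF_{X,\mathrm{y}_0}:=DF(p^*+A_1X+A_2\mathrm{y}_0),\qquad DF_{X,Y}:=DF(p^*+A_1X+A_2Y),$$ $$N(\mathrm{x}_0,\mathrm{y}_0,A_1,A_2,X,Y):=\mathrm{y}_0-[DF_{X,Y}A_2]^{-1}\bigl(F_{\mathrm{x}_0,\mathrm{y}_0}+[DF_{X,\mathrm{y}_0}A_1][X-\mathrm{x}_0]\bigr),$$ where every matrix in $[DF_{X,Y}A_2]$ is assumed invertible (so that $N$ is well defined). If $$N(\mathrm{x}_0,\mathrm{y}_0,A_1,A_2,X,Y)\subset Y,$$ then there exists a function $q:X\to Y$ such that $$F\bigl(p^*+A_1\mathrm{x}+A_2q(\mathrm{x})\bigr)=0\qquad\text{for all }\mathrm{x}\in X.$$ Moreover, $q$ is as smooth as $F$ (if $F$ is $C^r$, $r\ge1$, then so is $q$).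
   Context: Interval notation. For $U\subset\mathbb{R}^k$, $[U]$ denotes an interval enclosure of $U$: a product of closed intervals containing $U$. For a family $\mathbf{A}$ of $k\times l$ matrices, $[\mathbf{A}]$ denotes an interval enclosure: a set of all matrices whose $(i,j)$ entry lies in a given closed interval $[a_{ij},b_{ij}]$ for each $i,j$, containing $\mathbf{A}$. For sets, $[\mathbf{A}][U]$ denotes an interval enclosure of $\{Au: A\in[\mathbf{A}],u\in[U]\}$, and if every matrix in $[\mathbf{A}]$ is invertible, $[\mathbf{A}]^{-1}[U]$ denotes an interval enclosure of $\{A^{-1}u:A\in[\mathbf{A}],u\in[U]\}$. Sums and differences of points and sets are elementwise. For a set $U\subset\mathbb{R}^m$, $DF(U)$ denotes the family of derivatives $DF(u)$, $u\in U$, and for an interval enclosure $[DF(U)]$ each entry's interval contains the range over $U$ of the corresponding partial derivative. $DF_{X,Y}A_2$ denotes the family of products $MA_2$ with $M\in DF_{X,Y}$, and similarly for $DF_{X,\mathrm{y}_0}A_1$. *)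

(* Defs.v *)
From HB Require Import structures.
From mathcomp Require Import all_boot all_order all_algebra.
From mathcomp Require Import all_classical all_reals all_analysis.

Set Implicit Arguments.
Unset Strict Implicit.
Unset Printing Implicit Defensive.

Import Order.TTheory GRing.Theory Num.Theory.
Import numFieldNormedType.Exports.

Local Open Scope classical_set_scope.
Local Open Scope ring_scope.

Definition interval_mx (R : realType) (p q : nat) (lo hi : 'M[R]_(p, q)) :
  set 'M[R]_(p, q) := [set M | forall i j, lo i j <= M i j <= hi i j].

Definition interval_enclosure (R : realType) (p q : nat)
  (S B : set 'M[R]_(p, q)) : Prop :=
  S `<=` B /\ exists lo hi : 'M[R]_(p, q), B = interval_mx lo hi.

(* The library's [jacobian] acts on row vectors and is thus the transpose of
   the usual matrix of partial derivatives of a map between column vectors. *)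
Definition Dmx (R : realType) (m k : nat) (F : 'cV[R]_m -> 'cV[R]_k)
  (u : 'cV[R]_m) : 'M[R]_(k, m) :=
  \matrix_(i, j) ('D_(delta_mx j 0) F u) i 0.

(* Since [V] is meant to be finite-dimensional, a differentiable map is of class
   C^(r+1) iff all its directional derivatives are of class C^r. *)
Fixpoint Cn_on (R : realType) (V W : normedModType R) (r : nat) (U : set V)
  (f : V -> W) : Prop :=
  match r with
  | 0 => forall x, U x -> {for x, continuous f}
  | s.+1 => (forall x, U x -> differentiable f x) /\
            (forall v : V, Cn_on s U (fun x => 'D_v f x))
  end.

(* The order of smoothness is [Some r] for C^r and [None] for C^infinity;
   [U] is meant to be open. *)
Definition class_on (R : realType) (V W : normedModType R) (r : option nat)
  (U : set V) (f : V -> W) : Prop :=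
  match r with
  | Some n => Cn_on n U f
  | None => forall n, Cn_on n U f
  end.

(* Smoothness on a set that need not be open, such as a closed and possibly
   degenerate box: being the restriction of a map of the same class defined on
   an open neighbourhood of the set. *)
Definition class_on_closed (R : realType) (V W : normedModType R)
  (r : option nat) (X : set V) (f : V -> W) : Prop :=
  exists (U : set V) (g : V -> W),
    [/\ open U, X `<=` U, class_on r U g & forall x, X x -> g x = f x].

(* Main.v *)
(* For fixed x the map y |-> F (p + A1 x + A2 y) on the box Y has increments
   M (y - z) with M in the interval matrix [DF_XY A2]. Composing with the
   coordinatewise clamp onto Y and adding a fixed slope outside extends it to the
   whole space with increments still in that interval matrix. A map of this kind
   has a zero, namely any minimiser of its squared norm. The zero is
   y0 - M^-1 F(p + A1 x + A2 y0) for some admissible M, hence it lies in N and so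
   in Y. By compactness the argument survives a small enlargement of X, Y and of
   the interval matrix (which stays regular); the unique zero then depends
   continuously on x in an open neighbourhood of X, and it is differentiable with
   derivative - (DF A2)^-1 DF A1, which bootstraps to C^r. *)

Require Import Defs.
From HB Require Import structures.
From mathcomp Require Import all_boot all_order all_algebra.
From mathcomp Require Import all_classical all_reals all_analysis.
From mathcomp Require Import ring lra.

Set Implicit Arguments.
Unset Strict Implicit.
Unset Printing Implicit Defensive.

Import Order.TTheory GRing.Theory Num.Theory.
Import numFieldNormedType.Exports.

Local Open Scope classical_set_scope.
Local Open Scope ring_scope.

(** * Calculus of C^n maps *)

Section Smoothness.
Variables (R : realType) (V : normedModType R).

Lemma diff_eps (W : normedModType R) (f : V -> W) (x : V) :
  differentiable f x -> forall e : R, 0 < e ->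
  \forall h \near 0, `|f (h + x) - f x - 'd f x h| <= e * `|h|.
Proof.
move=> /diff_locallyP [_ df] e e0.
move/eqaddoP: df => /(_ e e0); apply: filterS => h /=.
by rewrite !fctE /= opprD addrA.
Qed.

Lemma eps_is_diff (W : normedModType R) (f : V -> W) (x : V)
    (L : {linear V -> W}) : continuous L ->
  (forall e : R, 0 < e ->
    \forall h \near 0, `|f (h + x) - f x - L h| <= e * `|h|) ->
  is_diff x f L.
Proof.
move=> Lc fL; have fE : f \o shift x = cst (f x) + L +o_ 0 id.
  apply/eqaddoP => e e0; apply: filterS (fL e e0) => h /=.
  by rewrite !fctE /= opprD addrA.
have dfx := diff_unique Lc fE.
by apply: DiffDef => //; apply/diff_locallyP; rewrite dfx.
Qed.

Lemma near_eq_differentiable (W : normedModType R) (f g : V -> W) (x : V) :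
  {near x, f =1 g} -> differentiable f x -> differentiable g x.
Proof.
move=> fg df; suff : is_diff x g ('d f x) by case.
apply: eps_is_diff; first exact: diff_continuous.
move=> e e0; have fx := nbhs_singleton fg.
have fgh : \forall h \near (0 : V), f (h + x) = g (h + x).
  by move: fg; rewrite (near_shift 0) /=; apply: filterS => h; rewrite subr0.
by apply: filterS2 fgh (diff_eps df e0) => h <-; rewrite fx.
Qed.

Lemma Cn_onW (W : normedModType R) n (U : set V) (f : V -> W) :
  Cn_on n.+1 U f -> Cn_on n U f.
Proof.
elim: n f => [f [df _] x Ux|n IH f [df Df]].
  exact: differentiable_continuous (df x Ux).
by split => // v; apply: IH; exact: Df.
Qed.

(** Openness turns equality on [U] into equality near each of its points, so the derivatives agree
    too. This allows a derivative to be replaced by a formula valid only on [U]. *)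
Lemma eq_Cn_on (W : normedModType R) n (U : set V) (f g : V -> W) :
  open U -> (forall x, U x -> f x = g x) -> Cn_on n U f -> Cn_on n U g.
Proof.
move=> oU; elim: n f g => [|n IH] f g fg.
  move=> cf x Ux; have nU : nbhs x U by exact: open_nbhs_nbhs.
  rewrite /prop_for /continuous_at -fg //; apply: cvg_trans (cf x Ux).
  by apply: near_eq_cvg; apply: filterS nU => y /fg.
case=> df Df; have nfg x : U x -> {near x, f =1 g}.
  by move=> Ux; apply: filterS (open_nbhs_nbhs (conj oU Ux)) => y /fg.
split=> [x Ux|v]; first exact: near_eq_differentiable (nfg x Ux) (df x Ux).
by apply: IH (Df v) => x /nfg; exact: near_eq_derive.
Qed.

Lemma Cn_on_cst (W : normedModType R) n (U : set V) (a : W) :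
  Cn_on n U (fun=> a).
Proof.
elim: n a => [a x _|n IH a]; first exact: cst_continuous.
split=> [x _|v]; first exact: differentiable_cst.
by under eq_fun do rewrite derive_cst; exact: IH.
Qed.

Lemma Cn_on_linear (W : normedModType R) n (U : set V) (f : {linear V -> W}) :
  continuous f -> Cn_on n U f.
Proof.
move=> cf; case: n => [x _|n]; first exact: cf.
split=> [x _|v]; first exact: linear_differentiable.
have -> : (fun x => 'D_v f x) = cst (f v).
  apply/funext => x; rewrite deriveE; last exact: linear_differentiable.
  by rewrite diff_lin.
exact: Cn_on_cst.
Qed.

Lemma Cn_onD (W : normedModType R) n (U : set V) (f g : V -> W) :
  open U -> Cn_on n U f -> Cn_on n U g -> Cn_on n U (fun x => f x + g x).
Proof.
move=> oU; elim: n f g => [|n IH] f g.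
  by move=> cf cg x Ux; apply: continuousD; [exact: cf|exact: cg].
move=> [df Df] [dg Dg]; split=> [x Ux|v].
  exact: differentiableD (df x Ux) (dg x Ux).
apply: (eq_Cn_on oU) (IH _ _ (Df v) (Dg v)) => x Ux /=.
by rewrite -deriveD //; apply: diff_derivable; [exact: df|exact: dg].
Qed.

Lemma Cn_onM n (U : set V) (f g : V -> R) :
  open U -> Cn_on n U f -> Cn_on n U g -> Cn_on n U (fun x => f x * g x).
Proof.
move=> oU; elim: n f g => [|n IH] f g.
  by move=> cf cg x Ux; apply: continuousM; [exact: cf|exact: cg].
move=> cf cg; have [df Df] := cf; have [dg Dg] := cg; split=> [x Ux|v].
  exact: differentiableM (df x Ux) (dg x Ux).
apply: (eq_Cn_on oU) (Cn_onD oU (IH _ _ (Cn_onW cf) (Dg v))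
  (IH _ _ (Cn_onW cg) (Df v))) => x Ux /=.
by rewrite [RHS]deriveM //; apply: diff_derivable; [exact: df|exact: dg].
Qed.

(** The derivative is minus the square of [1/f] times that of [f]. It contains [1/f] itself, whose
    smoothness one order lower is the induction hypothesis. *)
Lemma Cn_onV n (U : set V) (f : V -> R) :
  open U -> (forall x, U x -> f x != 0) -> Cn_on n U f ->
  Cn_on n U (fun x => (f x)^-1).
Proof.
move=> oU f0; elim: n => [|n IH].
  by move=> cf x Ux; apply: continuousV; [exact: f0|exact: cf].
move=> cf; have [df Df] := cf; split=> [x Ux|v].
  exact: differentiableV (df x Ux) (f0 x Ux).
have IHf := IH (Cn_onW cf).
apply: (eq_Cn_on oU) (Cn_onM oU (Cn_on_cst n U (-1 : R))
  (Cn_onM oU (Cn_onM oU IHf IHf) (Df v))) => x Ux /=.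
rewrite [RHS]deriveV ?f0 //; last by apply: diff_derivable; exact: df.
by rewrite mulN1r scaleNr expr2 invfM.
Qed.

Lemma Cn_on_sum (I : Type) (s : seq I) (P : pred I) n (U : set V)
    (f : I -> V -> R) :
  open U -> (forall i, Cn_on n U (f i)) ->
  Cn_on n U (fun x => \sum_(i <- s | P i) f i x).
Proof.
move=> oU cf; elim: s => [|i s IH].
  by under eq_fun do rewrite big_nil; exact: Cn_on_cst.
under eq_fun do rewrite big_cons.
by case: (P i) => //; exact: Cn_onD.
Qed.

Lemma Cn_on_prod (I : Type) (s : seq I) (P : pred I) n (U : set V)
    (f : I -> V -> R) :
  open U -> (forall i, Cn_on n U (f i)) ->
  Cn_on n U (fun x => \prod_(i <- s | P i) f i x).
Proof.
move=> oU cf; elim: s => [|i s IH].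
  by under eq_fun do rewrite big_nil; exact: Cn_on_cst.
under eq_fun do rewrite big_cons.
by case: (P i) => //; exact: Cn_onM.
Qed.

Lemma continuous_mxP p q (f : V -> 'M[R]_(p, q)) x :
  {for x, continuous f} <->
  forall i j, {for x, continuous (fun y => f y i j)}.
Proof.
split=> [cf i j|cf].
  exact: (continuous_comp cf (@coord_continuous _ _ _ i j (f x))).
move=> A [P fP PA]; apply: filterS (_ : \forall y \near x,
    forall i j, P i j (f y i j)); first by move=> y Py; exact: PA.
by apply: filter_forall => i; apply: filter_forall => j; exact: cf (fP i j).
Qed.

Lemma differentiable_mx p q (f : V -> 'M[R]_(p, q)) x :
  (forall i j, differentiable (fun y => f y i j) x) -> differentiable f x.
Proof.
move=> df; rewrite (_ : f = \sum_(i < p) \sum_(j < q)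
    (fun y => f y i j *: delta_mx i j)).
  by apply: differentiable_sum => i; apply: differentiable_sum => j;
    exact: differentiableZl.
apply/funext => y; rewrite [f y in LHS]matrix_sum_delta fct_sumE.
by apply: eq_bigr => i _; rewrite fct_sumE.
Qed.

Lemma Cn_on_mxP p q n (U : set V) (f : V -> 'M[R]_(p, q)) :
  open U -> Cn_on n U f <-> forall i j, Cn_on n U (fun x => f x i j).
Proof.
move=> oU; elim: n f => [|n IH] f.
  split=> [cf i j x Ux|cf x Ux]; first exact: (continuous_mxP _ _).1 (cf x Ux) i j.
  by apply/continuous_mxP => i j; exact: cf.
split=> [[df Df] i j|cf].
  split=> [x Ux|v].
    exact: (differentiable_comp (df x Ux) (differentiable_coord _ i j)).
  apply: (eq_Cn_on oU) ((IH _).1 (Df v) i j) => x Ux.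
  by rewrite derive_mx ?mxE //; apply: diff_derivable; exact: df.
have df x : U x -> differentiable f x.
  by move=> Ux; apply: differentiable_mx => i j; exact: (cf i j).1.
split=> // v; apply/IH => i j.
apply: (eq_Cn_on oU) ((cf i j).2 v) => x Ux.
by rewrite derive_mx ?mxE //; apply: diff_derivable; exact: df.
Qed.

Lemma derive_sum_delta (W : normedModType R) m (g : 'cV[R]_m -> W) u w :
  differentiable g u -> 'D_w g u = \sum_i w i 0 *: 'D_(delta_mx i 0) g u.
Proof.
move=> dg; rewrite deriveE // {1}[w]matrix_sum_delta raddf_sum /=.
by apply: eq_bigr => i _; rewrite big_ord1 linearZ deriveE.
Qed.

(** By the chain rule in coordinates, the derivative along [v] is the sum over [i] of the [i]-th
    entry of ['D_v f] times the [i]-th partial derivative of [g] at [f x]; the induction hypothesis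
    covers the latter. *)
Lemma Cn_on_comp m n (U : set V) (U' : set 'cV[R]_m)
    (f : V -> 'cV[R]_m) (g : 'cV[R]_m -> R) :
  open U -> (forall x, U x -> U' (f x)) ->
  Cn_on n U f -> Cn_on n U' g -> Cn_on n U (fun x => g (f x)).
Proof.
move=> oU fU; elim: n g => [|n IH] g.
  by move=> cf cg x Ux; apply: continuous_comp; [exact: cf|exact/cg/fU].
move=> cf [dg Dg]; have [df Df] := cf; split=> [x Ux|v].
  exact: (differentiable_comp (df x Ux) (dg _ (fU x Ux))).
apply: (eq_Cn_on oU) (Cn_on_sum (index_enum 'I_m) xpredT oU (fun i =>
  Cn_onM oU ((Cn_on_mxP n _ oU).1 (Df v) i 0) (IH _ (Cn_onW cf) (Dg (delta_mx i 0)))))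
  => x Ux /=.
have dfx := df x Ux; have dgx := dg _ (fU x Ux).
rewrite [RHS](_ : _ = 'D_('D_v f x) g (f x)).
  by rewrite derive_sum_delta.
by rewrite !deriveE // ?(diff_comp dfx dgx) //; exact: differentiable_comp.
Qed.

Lemma Cn_on_det k n (U : set V) (M : V -> 'M[R]_k) :
  open U -> (forall i j, Cn_on n U (fun x => M x i j)) ->
  Cn_on n U (fun x => \det (M x)).
Proof.
move=> oU cM; apply: Cn_on_sum => // s; apply: Cn_onM => //.
  exact: Cn_on_cst.
exact: Cn_on_prod.
Qed.

(** Cramer's rule: each entry is a cofactor divided by the determinant, and determinants are
    polynomials in the entries. *)
Lemma Cn_on_invmx k n (U : set V) (M : V -> 'M[R]_k) :
  open U -> (forall x, U x -> M x \in unitmx) ->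
  Cn_on n U M -> Cn_on n U (fun x => invmx (M x)).
Proof.
move=> oU uM /(Cn_on_mxP _ _ oU) cM; apply/Cn_on_mxP => // i j.
have dM x : U x -> \det (M x) != 0 by move=> /uM; rewrite unitmxE unitfE.
apply: (eq_Cn_on (f := fun x =>
    (\det (M x))^-1 * ((-1) ^+ (j + i) * \det (row' j (col' i (M x)))))) => //.
  by move=> x /uM uMx; rewrite /invmx uMx !mxE.
apply: Cn_onM => //; first by apply: Cn_onV => //; exact: Cn_on_det.
apply: Cn_onM => //; first exact: Cn_on_cst.
apply: Cn_on_det => // a b; rewrite (_ : (fun _ => _) =
  fun x => M x (lift j a) (lift i b)) //; by apply/funext => x; rewrite !mxE.
Qed.

Lemma Cn_on_mulmx p q r n (U : set V) (M : V -> 'M[R]_(p, q))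
    (N : V -> 'M[R]_(q, r)) :
  open U -> Cn_on n U M -> Cn_on n U N -> Cn_on n U (fun x => M x *m N x).
Proof.
move=> oU /(Cn_on_mxP _ _ oU) cM /(Cn_on_mxP _ _ oU) cN; apply/Cn_on_mxP => // i j.
under eq_fun do rewrite mxE.
by apply: Cn_on_sum => // l; exact: Cn_onM.
Qed.

End Smoothness.

(** * Interval matrices: compactness and regularity *)

Section IntervalMatrices.
Variable R : realType.

Lemma mx_norm_ler p q (A : 'M[R]_(p, q)) i j : `|A i j| <= `|A|.
Proof.
by rewrite {2}/Num.norm /= mx_normrE; apply: (le_bigmax _ _ (i, j)).
Qed.

Lemma mx_norm_le p q (A : 'M[R]_(p, q)) (e : R) :
  0 <= e -> (forall i j, `|A i j| <= e) -> `|A| <= e.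
Proof.
by move=> e0 Ae; rewrite {1}/Num.norm /= mx_normrE; apply: bigmax_le => // -[i j] _.
Qed.

Lemma mx_norm_mulmx p q r (A : 'M[R]_(p, q)) (B : 'M[R]_(q, r)) :
  `|A *m B| <= q%:R * `|A| * `|B|.
Proof.
apply: mx_norm_le => [|i j]; first by rewrite !mulr_ge0.
rewrite mxE (le_trans (ler_norm_sum _ _ _)) //.
apply: (@le_trans _ _ (\sum_(l < q) `|A| * `|B|)).
  by apply: ler_sum => l _; rewrite normrM ler_pM ?mx_norm_ler.
by rewrite sumr_const card_ord -[leLHS]mulr_natl mulrA.
Qed.

Lemma mulmx_continuous m p q (A : 'M[R]_(m, p)) :
  continuous (fun B : 'M[R]_(p, q) => A *m B).
Proof.
move=> B.
have cB : Cn_on 0 [set: 'M[R]_(p, q)] (@id 'M[R]_(p, q)) by move=> x _.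
exact: (Cn_on_mulmx openT (Cn_on_cst 0 setT A) cB).
Qed.

(** Flattened to a row vector, an interval matrix is a product of segments; compactness comes back
    through the continuous map [vec_mx]. *)
Lemma interval_mx_compact p q (lo hi : 'M[R]_(p, q)) :
  compact (interval_mx lo hi).
Proof.
have vec_mx_cont : continuous (vec_mx : 'rV[R]_(p * q) -> 'M[R]_(p, q)).
  move=> v; apply/continuous_mxP => i j.
  rewrite (_ : (fun _ => _) = fun w : 'rV[R]_(p * q) => w 0 (mxvec_index i j)).
    exact: coord_continuous.
  by apply/funext => w; rewrite mxE.
have -> : interval_mx lo hi = vec_mx @` [set v : 'rV[R]_(p * q) |
    forall l, `[mxvec lo 0 l, mxvec hi 0 l]%classic (v 0 l)].
  apply/seteqP; split=> [M lMh|_ [v vlh <-] i j].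
    exists (mxvec M); last exact: mxvecK.
    by move=> l; case/mxvec_indexP: l => i j; rewrite /= in_itv /= !mxvecE.
  by have := vlh (mxvec_index i j); rewrite /= in_itv /= !mxvecE mxE.
apply: continuous_compact; first exact: continuous_subspaceT.
apply: (@rV_compact R _ (fun l => `[mxvec lo 0 l, mxvec hi 0 l]%classic)) => l.
exact: segment_compact.
Qed.

Lemma interval_mx_bounded p q (lo hi : 'M[R]_(p, q)) :
  exists2 B : R, 0 < B & forall M, interval_mx lo hi M -> `|M| < B.
Proof.
have /ex_strict_bound_gt0[B B0 HB] : bounded_set (interval_mx lo hi).
  exact/compact_bounded/interval_mx_compact.
by exists B.
Qed.

(** A Lebesgue-number argument: if the ball of radius [r] about [x] lies in [O], the radius [r / 2]
    works for all points within [r / 2] of [x], and compactness gives one radius for all of [K]. *)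
Lemma compact_uniform_ball (W : normedModType R) (K : set W) (O : set W) :
  compact K -> (forall x, K x -> nbhs x O) ->
  exists2 e : R, 0 < e & forall x y, K x -> `|x - y| < e -> O y.
Proof.
move=> /compact_near_coveringP cK KO.
have nK : \forall e \near (0 : R)^'+,
    K `<=` (fun x => forall y, `|x - y| < e -> O y).
  apply: cK => x Kx.
  have /nbhs_ballP[r /= r0 rO] := KO x Kx.
  near=> x' e => /= y x'y; apply: rO; rewrite -ball_normE /=.
  rewrite -(subrKA x') (le_lt_trans (ler_normD _ _)) // (splitr r) ltrD //.
    near: x'; apply/nbhs_ballP; exists (r / 2); first exact: divr_gt0.
    by move=> z; rewrite -ball_normE.
  rewrite (lt_le_trans x'y) //; near: e; apply: nbhs_right_le; exact: divr_gt0.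
near (0 : R)^'+ => e; exists e => // x y Kx xy.
have nKe : K `<=` (fun x => forall y, `|x - y| < e -> O y) by near: e.
exact: nKe xy.
Unshelve. all: by end_near. Qed.

(** Clamping each entry between [lo i j] and [hi i j] moves it by at most [e]. Nonemptiness gives
    [lo i j <= hi i j], so the clamped matrix does lie in the interval matrix. *)
Lemma clamp_interval_mx p q (lo hi M : 'M[R]_(p, q)) (e : R) :
  0 <= e -> interval_mx lo hi !=set0 ->
  interval_mx (lo - const_mx e) (hi + const_mx e) M ->
  exists2 M', interval_mx lo hi M' & `|M' - M| <= e.
Proof.
move=> e0 [M0 M0P] MP.
exists (\matrix_(i, j) Num.max (lo i j) (Num.min (hi i j) (M i j))).
  move=> i j; rewrite mxE; have /andP[l h] := M0P i j.
  by rewrite le_max lexx /= ge_max ge_min lexx (le_trans l h).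
apply: mx_norm_le => // i j; rewrite !mxE.
move: (MP i j) (M0P i j); rewrite !mxE.
move: (lo i j) (hi i j) (M i j) (M0 i j) => l h m m0 /andP[? ?] /andP[? ?].
rewrite ler_norml.
by case: (leP h m) => ?; [case: (leP l h)|case: (leP l m)] => ?;
  apply/andP; split; lra.
Qed.

Lemma open_unitmx k : open [set M : 'M[R]_k | M \in unitmx].
Proof.
have det_cont : continuous (fun M : 'M[R]_k => \det M).
  move=> M; have cM i j : Cn_on 0 [set: 'M[R]_k] (fun N : 'M[R]_k => N i j).
    by move=> N _; exact: coord_continuous.
  exact: (Cn_on_det openT cM).
rewrite (_ : mkset _ = (fun M : 'M[R]_k => \det M) @^-1` [set x | x != 0]).
  by apply: open_comp; [move=> M _; exact: det_cont | exact: open_neq].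
by apply/funext => M /=; rewrite unitmxE unitfE.
Qed.

(** The invertible matrices form an open set containing a compact interval matrix, hence also a
    uniform neighbourhood of it. *)
Lemma unit_interval_mx_fatten k (lo hi : 'M[R]_k) :
  interval_mx lo hi !=set0 ->
  (forall M, interval_mx lo hi M -> M \in unitmx) ->
  exists2 e : R, 0 < e & forall M,
    interval_mx (lo - const_mx e) (hi + const_mx e) M -> M \in unitmx.
Proof.
move=> IM0 uIM.
have [M /uIM uM|e e0 He] := compact_uniform_ball
    (O := [set M : 'M[R]_k | M \in unitmx]) (@interval_mx_compact _ _ lo hi).
  by apply: open_nbhs_nbhs; split => //; exact: open_unitmx.
(* Half the radius: clamping yields a non-strict bound, while the ball is strict. *)
exists (e / 2) => [|M MP]; first exact: divr_gt0.
have [||M' M'P M'M] := clamp_interval_mx _ _ MP => //; first by rewrite ltW ?divr_gt0.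
apply: He M'P _; apply: le_lt_trans M'M _; lra.
Qed.

(** Inversion is continuous on the compact interval matrix, so the inverses are bounded there, and
    [v] is the inverse applied to [M *m v]. *)
Lemma unit_interval_mx_expand k (lo hi : 'M[R]_k) :
  (forall M, interval_mx lo hi M -> M \in unitmx) ->
  exists2 C : R, 0 < C & forall M, interval_mx lo hi M ->
    forall v : 'cV[R]_k, `|v| <= C * `|M *m v|.
Proof.
move=> uIM.
have inv_cont : {within interval_mx lo hi, continuous (@invmx R k)}.
  apply: continuous_in_subspaceT => M; rewrite inE => MP.
  have cid : Cn_on 0 [set M : 'M[R]_k | M \in unitmx] (@id 'M[R]_k) by move=> x _.
  have cinv := Cn_on_invmx (@open_unitmx k) (fun _ => id) cid.
  exact: cinv M (uIM _ MP).
have /ex_strict_bound_gt0[C C0 HC] : bounded_set (@invmx R k @` interval_mx lo hi).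
  by apply/compact_bounded/continuous_compact => //; exact: interval_mx_compact.
(* The factor [k] comes from the product bound for the entrywise maximum norm; adding 1 keeps the
   constant positive when [k] is 0. *)
exists (k%:R * C + 1) => [|M MP v].
  by rewrite ltr_wpDl // mulr_ge0 // ltW.
rewrite -{1}[v](mulKmx (uIM _ MP)) (le_trans (mx_norm_mulmx _ _)) //.
rewrite ler_wpM2r // (@le_trans _ _ (k%:R * C)) ?lerDl //.
by rewrite ler_wpM2l // ltW // HC //; exists M.
Qed.

End IntervalMatrices.

(** * Zeros of maps with increments in a regular interval matrix *)

Section IntervalMaps.
Variables (R : realType) (k : nat) (lo hi : 'M[R]_k).
Let IM := interval_mx lo hi.
Hypotheses (IM0 : IM !=set0) (uIM : forall M, IM M -> M \in unitmx).

Lemma interval_mx_le i j : lo i j <= hi i j.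
Proof. by case: IM0 => M MP; have /andP[/le_trans] := MP i j; apply. Qed.

(** The columns of an admissible matrix vary independently. If for every [j] the range of the [j]-th
    entry of [r^T *m M] contained 0, a single admissible [M] would satisfy [r^T *m M = 0], against
    invertibility. So some entry keeps a fixed sign and stays away from 0. *)
Lemma unit_interval_mx_col_sign (r : 'cV[R]_k) : r != 0 ->
  exists j (s e : R), [/\ `|s| = 1, 0 < e &
    forall M, IM M -> e <= s * \sum_i r i 0 * M i j].
Proof.
move=> r0.
(* [L] and [H] choose, by the sign of [r i 0], the endpoints that minimise and maximise
   [r i 0 * M i j]. *)
pose L := \matrix_(i, j) if 0 <= r i 0 then lo i j else hi i j.
pose H := \matrix_(i, j) if 0 <= r i 0 then hi i j else lo i j.
pose l j := \sum_i r i 0 * L i j.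
pose u j := \sum_i r i 0 * H i j.
have lM M j : IM M -> l j <= \sum_i r i 0 * M i j.
  move=> MP; apply: ler_sum => i _; have /andP[? ?] := MP i j; rewrite mxE.
  by case: (lerP 0 (r i 0)) => ri; [rewrite ler_wpM2l|rewrite ler_wnM2l // ltW].
have Mu M j : IM M -> \sum_i r i 0 * M i j <= u j.
  move=> MP; apply: ler_sum => i _; have /andP[? ?] := MP i j; rewrite mxE.
  by case: (lerP 0 (r i 0)) => ri; [rewrite ler_wpM2l|rewrite ler_wnM2l // ltW].
have [[j lj]|nl] := pselect (exists j, 0 < l j).
  by exists j, 1, (l j); split; rewrite ?normr1 // => M /lM; rewrite mul1r.
have [[j uj]|nu] := pselect (exists j, u j < 0).
  exists j, (-1), (- u j); split; rewrite ?normrN1 ?oppr_gt0 // => M /Mu.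
  by rewrite mulN1r lerN2.
have {}nl j : l j <= 0 by rewrite leNgt; apply/negP => lj; apply: nl; exists j.
have {}nu j : 0 <= u j by rewrite leNgt; apply/negP => uj; apply: nu; exists j.
(* The weight that makes [th j * l j + (1 - th j) * u j] vanish. If [u j = l j], division by zero
   gives weight 0, which is right since both are then 0. *)
pose th j := u j / (u j - l j).
have th01 j : 0 <= th j <= 1.
  have := nl j; have := nu j; rewrite /th => u0 l0.
  rewrite divr_ge0 ?subr_ge0 ?(le_trans l0) //=.
  have [->|ul] := eqVneq (u j - l j) 0; first by rewrite invr0 mulr0 ler01.
  by rewrite ler_pdivrMr ?mul1r ?lerDl ?oppr_ge0 // lt0r ul subr_ge0 (le_trans l0).
pose M := \matrix_(i, j) (th j * L i j + (1 - th j) * H i j).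
have MP : IM M.
  move=> i j; have /andP[t0 t1] := th01 j; have := interval_mx_le i j.
  by rewrite !mxE; case: ifP => _ lh; apply/andP; split; nra.
have rM : r^T *m M = 0.
  apply/rowP => j; rewrite !mxE.
  under eq_bigr do rewrite !mxE mulrDr (mulrCA (r _ _)) [X in _ + X]mulrCA.
  rewrite big_split -!mulr_sumr /=.
  transitivity (th j * l j + (1 - th j) * u j).
    by congr (_ * _ + _ * _); apply: eq_bigr => i _; rewrite mxE.
  rewrite /th; have [ul|ul] := eqVneq (u j - l j) 0; last by field.
  have := nl j; have := nu j; move: ul => ul u0 l0.
  have -> : u j = 0 by lra.
  by rewrite !mul0r mulr0 addr0.
move: r0; rewrite -[r]trmxK -[r^T](mulmxK (uIM MP)) rM mul0mx trmx0 eqxx.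
by [].
Qed.

(** A stand-in for a derivative with values in the interval matrix that, unlike differentiability,
    survives the extension by clamping below. The matrix may depend on the pair of points. *)
Definition interval_increments (f : 'cV[R]_k -> 'cV[R]_k) (Y : set 'cV[R]_k) :=
  forall y z, Y y -> Y z -> exists2 M, IM M & f y - f z = M *m (y - z).

Lemma interval_increments_continuous f :
  interval_increments f setT -> continuous f.
Proof.
move=> fI y; have [B B0 HB] := interval_mx_bounded lo hi.
have K0 : 0 < k%:R * B + 1 by rewrite ltr_wpDl // mulr_ge0 // ltW.
apply: (cvgrPdist_lt (F := nbhs y) f (f y)).2 => e e0; apply/nbhs_ballP.
exists (e / (k%:R * B + 1)) => [|z]; first exact: divr_gt0.
rewrite -ball_normE /= ltr_pdivlMr // mulrC => yz.
have [M MP ->] := fI y z I I.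
rewrite (le_lt_trans (mx_norm_mulmx _ _)) // (le_lt_trans _ yz) //.
rewrite ler_wpM2r // (@le_trans _ _ (k%:R * B)) ?lerDl //.
by rewrite ler_wpM2l // ltW // HB.
Qed.

(* Minimise |f|^2: at a minimiser with f y <> 0 some column of every admissible
   increment matrix makes an angle of the same sign with f y, so that moving
   along that coordinate decreases |f|^2. *)
Lemma interval_increments_zero f :
  interval_increments f setT -> exists y, f y = 0.
Proof.
move=> fI; have cf := interval_increments_continuous fI.
have [B B0 HB] := interval_mx_bounded lo hi.
have [C C0 HC] := unit_interval_mx_expand uIM.
pose phi y := \sum_i f y i 0 * f y i 0.
have phi_cont : continuous phi.
  have c0f : Cn_on 0 setT f by move=> y _; exact: cf.
  have cfi i : Cn_on 0 setT (fun y => f y i 0).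
    exact: (Cn_on_mxP 0 f openT).1 c0f i 0.
  by move=> y; exact: (Cn_on_sum (index_enum 'I_k) xpredT openT
    (fun i => Cn_onM openT (cfi i) (cfi i))).
have phi_ge0 y : 0 <= phi y by apply: sumr_ge0 => i _; rewrite -expr2 sqr_ge0.
(* If [phi z < phi 0], the entries of [f z] are at most [1 + phi 0] in absolute value, and the
   expansion bound gives [|z| <= rho]. Hence the minimum over the cube [K] is global. *)
pose rho := C * (1 + phi 0 + `|f 0|).
have rho0 : 0 <= rho by rewrite mulr_ge0 ?addr_ge0 // ltW.
pose K : set 'cV[R]_k := interval_mx (const_mx (- rho)) (const_mx rho).
have K0 : K 0 by move=> i j; rewrite !mxE oppr_le0 rho0.
have [y yK ymin] := compact_EVT_min (ex_intro _ _ K0)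
  (interval_mx_compact (lo := _) (hi := _)) (continuous_subspaceT phi_cont).
have {}ymin z : phi y <= phi z.
  have [zK|zK] := pselect (K z); first by apply: ymin; rewrite inE.
  apply: (@le_trans _ _ (phi 0)); first by apply: ymin; rewrite inE.
  rewrite leNgt; apply/negP => zlt; apply: zK => i j.
  rewrite !mxE -ler_norml (le_trans (mx_norm_ler _ _ _)) //.
  have [M MP fM] := fI z 0 I I; have := HC M MP z; rewrite -[z in M *m z]subr0 -fM.
  move=> /le_trans; apply; rewrite /rho ler_wpM2l ?(ltW C0) //.
  rewrite (le_trans (ler_normB _ _)) // lerD2r mx_norm_le ?addr_ge0 // => a b.
  rewrite ord1; have : f z a 0 * f z a 0 <= phi 0.
    rewrite (le_trans _ (ltW zlt)) // /phi (bigD1 a) //= lerDl.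
    by apply: sumr_ge0 => l _; rewrite -expr2 sqr_ge0.
  by have := phi_ge0 0; rewrite ler_norml => ? ?; apply/andP; split; nra.
exists y; apply/eqP; apply: contraT => fy0.
have [j [s [e [s1 e0 He]]]] := unit_interval_mx_col_sign fy0.
pose B2 := k%:R * (B * B).
have B20 : 0 <= B2 by rewrite !mulr_ge0 // ltW.
(* The step length gives [t * B2 <= e], where [B2] bounds the squared length of a column. Then [phi]
   changes by at most [- 2 * t * e + t * t * B2 <= - t * e]. *)
pose t := e / (B2 + 1).
have t0 : 0 < t by rewrite divr_gt0 // ltr_wpDl.
have tB2 : t * B2 <= e.
  by rewrite /t mulrAC ler_pdivrMr ?ltr_wpDl // ler_wpM2l ?(ltW e0) // lerDl.
pose z := y - (t * s) *: delta_mx j 0.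
(* [M] depends on the step taken, but the bound [He] holds for all admissible matrices. *)
have [M MP fM] := fI z y I I.
have fz i : f z i 0 = f y i 0 - t * s * M i j.
  have := congr1 (fun A : 'cV[R]_k => A i 0) fM.
  rewrite /z addrAC subrr add0r mulmxN -scalemxAr -colE !mxE => E; lra.
have := ymin z; rewrite leNgt => /negP; case.
have s2 : s * s = 1 by rewrite -expr2 -real_normK ?num_real // s1 expr1n.
have -> : phi z = phi y - t * (2 * (s * \sum_i f y i 0 * M i j))
    + t * t * \sum_i M i j * M i j.
  rewrite /phi !mulr_sumr -sumrN -!big_split /=; apply: eq_bigr => i _.
  rewrite fz; transitivity (f y i 0 * f y i 0 - t * (2 * (s * (f y i 0 * M i j)))
    + t * t * (s * s) * (M i j * M i j)); first by ring.
  by rewrite s2 mulr1.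
have sumB : \sum_i M i j * M i j <= B2.
  apply: (@le_trans _ _ (\sum_(i < k) B * B)).
    apply: ler_sum => i _; rewrite -expr2 -real_normK ?num_real // expr2.
    by apply: ler_pM => //; exact: ltW (le_lt_trans (mx_norm_ler _ _ _) (HB _ MP)).
  by rewrite sumr_const card_ord -mulr_natl.
have tsum : t * t * (\sum_i M i j * M i j) <= t * e.
  by rewrite -mulrA ler_wpM2l ?(ltW t0) // (le_trans _ tB2) // ler_wpM2l // ltW.
have := He M MP; rewrite -(ler_pM2l t0) => te.
have : 0 < t * e by rewrite mulr_gt0.
lra.
Qed.

(** * Extension of a map from a box to the whole space *)

Variables c d : 'cV[R]_k.
Hypothesis cd : interval_mx c d !=set0.
Let Y := interval_mx c d.

Definition clamp (y : 'cV[R]_k) : 'cV[R]_k :=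
  \col_i Num.max (c i 0) (Num.min (d i 0) (y i 0)).

Lemma clamp_in y : Y (clamp y).
Proof.
case: cd => y0 y0Y i j; rewrite ord1 mxE; have /andP[l h] := y0Y i 0.
by rewrite le_max lexx /= ge_max ge_min lexx (le_trans l h).
Qed.

Lemma clamp_id y : Y y -> clamp y = y.
Proof.
move=> yY; apply/colP => i; rewrite mxE; have /andP[l h] := yY i 0.
by rewrite min_r // max_r.
Qed.

(** In each coordinate the clamp is nondecreasing and does not increase distances, so its difference
    quotients lie between 0 and 1. *)
Lemma clamp_slope (y z : 'cV[R]_k) i : exists2 t : R, 0 <= t <= 1 &
  clamp y i 0 - clamp z i 0 = t * (y i 0 - z i 0).
Proof.
case: cd => y0 y0Y; have /andP[] := y0Y i 0; rewrite !mxE.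
move: (c i 0) (d i 0) (y0 i 0) (y i 0) (z i 0) => l h m v w lm mh.
have [->|vw] := eqVneq v w; first by exists 0; rewrite ?lexx ?ler01 // !subrr mulr0.
wlog ltvw : v w vw / w < v => [hw|].
  have [wv|vw'|/eqP] := ltgtP w v; first exact: hw wv.
    have [|t t01 E] := hw w v _ vw'; first by rewrite eq_sym.
    by exists t => //; lra.
  by rewrite eq_sym (negbTE vw).
exists ((Num.max l (Num.min h v) - Num.max l (Num.min h w)) / (v - w)); last first.
  by rewrite divfK // subr_eq0.
rewrite ler_pdivrMr ?subr_gt0 // mul1r ler_pdivlMr ?subr_gt0 // mul0r.
case: (leP h v) => ?; [case: (leP l h)|case: (leP l v)] => ?;
(case: (leP h w) => ?; [case: (leP l h)|case: (leP l w)] => ?); apply/andP; split; lra.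
Qed.

(* Beyond the box the extension has constant slope [M0], so that all its
   increments are still governed by the same interval matrix. *)
Definition box_extension (M0 : 'M[R]_k) (f : 'cV[R]_k -> 'cV[R]_k) y :=
  f (clamp y) + M0 *m (y - clamp y).

(** With [th j] the slope of the clamp in coordinate [j], the [j]-th column of the increment matrix
    averages those of [M] and [M0] with weights [th j] and [1 - th j]. The constraints are
    entrywise, so the weights may differ between columns. *)
Lemma box_extension_increments M0 f : IM M0 ->
  interval_increments f Y -> interval_increments (box_extension M0 f) setT.
Proof.
move=> M0P fI y z _ _.
have [M MP fM] := fI _ _ (clamp_in y) (clamp_in z).
have [th thP] := choice (fun i => let: ex_intro2 t a b := clamp_slope y z i in
  ex_intro (fun t => 0 <= t <= 1 /\ clamp y i 0 - clamp z i 0 = t * (y i 0 - z i 0))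
    t (conj a b)).
exists (\matrix_(i, j) (th j * M i j + (1 - th j) * M0 i j)).
  move=> i j; have [/andP[t0 t1] _] := thP j; rewrite mxE.
  have /andP[? ?] := MP i j; have /andP[? ?] := M0P i j.
  by apply/andP; split; nra.
rewrite /box_extension opprD addrACA -mulmxBr fM; apply/colP => i.
rewrite !mxE -big_split /=; apply: eq_bigr => j _.
have [_] := thP j; move: (clamp y) (clamp z) => cy cz; rewrite !mxE => E.
have -> : M0 i j * (y j 0 - cy j 0 - (z j 0 - cz j 0)) =
  M0 i j * (y j 0 - z j 0 - (cy j 0 - cz j 0)) by ring.
rewrite E; ring.
Qed.

Lemma box_extensionE M0 f y : Y y -> box_extension M0 f y = f y.
Proof. by move=> yY; rewrite /box_extension clamp_id // subrr mulmx0 addr0. Qed.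

End IntervalMaps.

(** * Mean value theorem and implicit differentiation *)

Section ImplicitFunction.
Variables (R : realType) (m k : nat) (F : 'cV[R]_m -> 'cV[R]_k).

Lemma Dmx_mulmx u w : differentiable F u -> Dmx F u *m w = 'D_w F u.
Proof.
move=> dF; rewrite derive_sum_delta //; apply/colP => i; rewrite !mxE summxE.
by apply: eq_bigr => j _; rewrite !mxE mulrC.
Qed.

Lemma Cn_on_Dmx n (U : set 'cV[R]_m) :
  open U -> Cn_on n.+1 U F -> Cn_on n U (Dmx F).
Proof.
move=> oU [_ DF]; apply/Cn_on_mxP => // i j.
rewrite (_ : (fun _ => _) = fun u => 'D_(delta_mx j 0) F u i 0).
  exact: (Cn_on_mxP n _ oU).1 (DF _) i 0.
by apply/funext => u; rewrite mxE.
Qed.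

Lemma MVT_row (u w : 'cV[R]_m) i : (forall v, differentiable F v) ->
  exists2 t : R, 0 <= t <= 1 &
    (F (u + w) - F u) i 0 = (Dmx F (u + t *: w) *m w) i 0.
Proof.
move=> dF; pose line (t : R) : 'cV[R]_m := u + t *: w.
have dline (t : R) : is_diff t line ( *:%R ^~ w).
  by have := is_diffD (is_diff_cst u t) (is_diff_scalel t w); rewrite add0r.
pose g (t : R) : R := F (line t) i 0.
have dg (t : R) : is_derive t 1 g ((Dmx F (u + t *: w) *m w) i 0).
  have dFl : differentiable (F \o line) t by apply: differentiable_comp.
  have dFl1 : 'D_1 (F \o line) t = Dmx F (line t) *m w.
    rewrite deriveE // diff_comp // (diff_val (is_diff_def := dline t)) /= scale1r.
    by rewrite Dmx_mulmx // deriveE.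
  split.
    apply: diff_derivable.
    exact: (differentiable_comp dFl (differentiable_coord _ i 0)).
  rewrite -[u + _]/(line t) -dFl1 derive_mx ?mxE //; exact: diff_derivable.
have [|t] := @MVT_segment R g _ 0 1 ler01 (fun t _ => dg t).
  apply: continuous_subspaceT => t; apply: differentiable_continuous.
  by apply/derivable1_diffP; case: (dg t).
rewrite in_itv /= => t01 E; exists t => //.
by move: E; rewrite subr0 mulr1 /g /line scale0r addr0 scale1r !mxE.
Qed.

Variables (n : nat) (p : 'cV[R]_m) (A1 : 'M[R]_(m, n)) (A2 : 'M[R]_(m, k)).
Variables (U : set 'cV[R]_n) (q : 'cV[R]_n -> 'cV[R]_k).
Hypotheses (oU : open U) (cq : forall x, U x -> {for x, continuous q}).
Let arg x := p + A1 *m x + A2 *m q x.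
Hypotheses (Fq : forall x, U x -> F (arg x) = 0)
  (uq : forall x, U x -> Dmx F (arg x) *m A2 \in unitmx)
  (dF : forall u, differentiable F u).

(** Write [De h] for the increment of [q]. Since [F] vanishes along [arg], its linearisation gives
    [D *m h + B *m De h] of size at most [e' * |w h|]. Applying [invmx B] bounds the error [X] by a
    small multiple of [|h| + |De h|], and [|De h| <= X + l * |h|], so for small [e'] the term in [X]
    is absorbed. *)
Lemma implicit_is_diff x : U x ->
  is_diff x q (mulmx (- (invmx (Dmx F (arg x) *m A2) *m (Dmx F (arg x) *m A1)))).
Proof.
move=> Ux; set B := Dmx F (arg x) *m A2; set D := Dmx F (arg x) *m A1.
set L := - (invmx B *m D).
apply: (eps_is_diff (L := mulmx L)); first exact: mulmx_continuous.
move=> e e0; pose a1 := n%:R * `|A1|; pose a2 := k%:R * `|A2|.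
pose be := k%:R * `|invmx B|; pose l := n%:R * `|L|.
have [a10 a20 be0 l0] : [/\ 0 <= a1, 0 <= a2, 0 <= be & 0 <= l].
  by split; apply: mulr_ge0.
(* [K] collects the two requirements [e'1], which absorbs half of [X], and [e'2], which leaves at
   most [e * |h|]. *)
pose K := 2 * be * (a1 + a2 * l) + 2 * be * a2 + 1.
have K0 : 0 < K.
  by rewrite /K ltr_wpDl // !(addr_ge0, mulr_ge0).
pose e' := Num.min e 1 / K.
have e'0 : 0 < e' by rewrite divr_gt0 // lt_min e0 ltr01.
have e'K : e' * K = Num.min e 1 by rewrite divfK // gt_eqF.
have e'1 : 2 * be * a2 * e' <= 1.
  have : e' * K <= 1 by rewrite e'K ge_min lexx orbT.
  apply: le_trans; rewrite mulrC ler_wpM2l ?(ltW e'0) // /K.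
  by rewrite -addrA ler_wpDl ?lerDl // !(addr_ge0, mulr_ge0).
have e'2 : 2 * be * (a1 + a2 * l) * e' <= e.
  have : e' * K <= e by rewrite e'K ge_min lexx.
  apply: le_trans; rewrite mulrC ler_wpM2l ?(ltW e'0) // /K.
  by rewrite -addrA lerDl !(addr_ge0, mulr_ge0).
pose De (h : 'cV[R]_n) : 'cV[R]_k := q (h + x) - q x.
pose w (h : 'cV[R]_n) : 'cV[R]_m := A1 *m h + A2 *m De h.
have wE h : arg (h + x) = w h + arg x.
  rewrite /arg /w /De mulmxDr mulmxBr.
  move: (A1 *m h) (A1 *m x) (A2 *m q _) (A2 *m q _) => s1 s2 s3 s4.
  by apply/matrixP => i j; rewrite !mxE; ring.
have De0 : De h @[h --> (0 : 'cV[R]_n)] --> (0 : 'cV[R]_k).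
  apply: (cvgrPdist_lt (F := nbhs (0 : 'cV[R]_n)) De 0).2 => e1 e10.
  have : \forall z \near x, `|q x - q z| < e1.
    exact: (cvgrPdist_lt (F := nbhs x) q (q x)).1 (cq Ux) e1 e10.
  rewrite (near_shift 0) /=; apply: filterS => h.
  by rewrite subr0 sub0r normrN distrC.
have w0 : w h @[h --> (0 : 'cV[R]_n)] --> (0 : 'cV[R]_m).
  have -> : (0 : 'cV[R]_m) = 0 + 0 by rewrite addr0.
  apply: (cvgD (F := nbhs (0 : 'cV[R]_n)) (f := mulmx A1) (g := mulmx A2 \o De)).
    by rewrite -[X in _ --> X](mulmx0 1 A1); exact: mulmx_continuous.
  apply: (cvg_comp _ _ De0).
  by rewrite -[X in _ `=>` nbhs X](mulmx0 1 A2); exact: mulmx_continuous.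
have nU : \forall h \near (0 : 'cV[R]_n), U (h + x).
  have := open_nbhs_nbhs (conj oU Ux).
  by rewrite -[nbhs x U]/(\forall y \near x, U y) (near_shift 0) /=;
    apply: filterS => h; rewrite subr0.
have nF : \forall h \near (0 : 'cV[R]_n),
    `|F (w h + arg x) - F (arg x) - 'd F (arg x) (w h)| <= e' * `|w h|.
  exact: w0 (diff_eps (dF (arg x)) e'0).
apply: filterS2 nU nF => h Uh; rewrite -wE !Fq // subrr sub0r normrN.
rewrite -deriveE // -Dmx_mulmx // mulmxDr !mulmxA -/B -/D => Hw.
have DeL : De h - L *m h = invmx B *m (D *m h + B *m De h).
  have uB : B \in unitmx := uq Ux.
  rewrite mulmxDr mulKmx // (mulmxA _ D h) /L mulNmx opprK; exact: addrC.
rewrite -/(De h); set X := `|De h - L *m h|.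
have X1 : X <= be * (e' * (a1 * `|h| + a2 * `|De h|)).
  rewrite /X DeL (le_trans (mx_norm_mulmx _ _)) // ler_wpM2l //.
  rewrite (le_trans Hw) // ler_wpM2l ?(ltW e'0) //.
  by rewrite (le_trans (ler_normD _ _)) // lerD // mx_norm_mulmx.
have X2 : `|De h| <= X + l * `|h|.
  rewrite -{1}(subrK (L *m h) (De h)) (le_trans (ler_normD _ _)) // lerD2l.
  exact: mx_norm_mulmx.
have X0 : 0 <= X := normr_ge0 _.
have h0 : 0 <= `|h| := normr_ge0 _.
have X3 : X <= be * (e' * (a1 * `|h| + a2 * (X + l * `|h|))).
  rewrite (le_trans X1) // ler_wpM2l // ler_wpM2l ?(ltW e'0) // lerD2l.
  by rewrite ler_wpM2l.
have := ler_wpM2r X0 e'1; have := ler_wpM2r h0 e'2.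
move: X3; move: X `|h| {X1 X2 X0 h0} => X y *; lra.
Qed.

(** The formula for the derivative involves only first derivatives of [F] at [arg x], so one order
    is lost for [F] but none for [q]. *)
Let Cn_on_derive r v : Cn_on r.+1 setT F -> Cn_on r U q -> Cn_on r U ('D_v q).
Proof.
move=> cF cnq.
have carg : Cn_on r U arg.
  apply: (Cn_onD oU); last exact: Cn_on_mulmx oU (Cn_on_cst r U A2) cnq.
  apply: (Cn_onD oU (Cn_on_cst r U p)).
  apply: (Cn_on_mulmx oU (Cn_on_cst r U A1)).
  by apply: (@Cn_on_linear R _ _ r U idfun) => x.
have cDF : Cn_on r U (fun x => Dmx F (arg x)).
  apply/(Cn_on_mxP _ _ oU) => i j.
  apply: (Cn_on_comp (U' := setT) (g := fun u => Dmx F u i j) oU _ carg) => //.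
  exact: (Cn_on_mxP r _ openT).1 (Cn_on_Dmx openT cF) i j.
have cinv := Cn_on_invmx oU uq (Cn_on_mulmx oU cDF (Cn_on_cst r U A2)).
apply: eq_Cn_on oU _ (Cn_on_mulmx oU (Cn_on_cst r U (- 1%:M))
  (Cn_on_mulmx oU (Cn_on_mulmx oU cinv (Cn_on_mulmx oU cDF (Cn_on_cst r U A1)))
    (Cn_on_cst r U v))) => x Ux /=.
have dq := implicit_is_diff Ux.
by rewrite deriveE; [rewrite diff_val mulNmx mul1mx mulNmx | case: dq].
Qed.

Lemma implicit_Cn_on r : Cn_on r.+1 setT F -> Cn_on r.+1 U q.
Proof.
have dq x : U x -> differentiable q x by case/implicit_is_diff.
elim: r => [|r IH] cF; split=> // v; apply: Cn_on_derive => //.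
by apply: IH; exact: Cn_onW.
Qed.

End ImplicitFunction.

(** * The interval Newton step and derivative enclosures *)

Section IntervalNewton.
Variables (R : realType).

(** The extension of [g] has a zero [y] somewhere. Its increment from [y0] to [y] gives
    [- g y0 = M *m (y - y0)], so [y] is a Newton image, hence in the box, where the extension is
    [g]. *)
Lemma interval_newton_zero k (lo hi : 'M[R]_k) (c d y0 : 'cV[R]_k)
    (g : 'cV[R]_k -> 'cV[R]_k) :
  interval_mx lo hi !=set0 ->
  (forall M, interval_mx lo hi M -> M \in unitmx) ->
  interval_mx c d y0 -> interval_increments lo hi g (interval_mx c d) ->
  (forall M, interval_mx lo hi M -> interval_mx c d (y0 - invmx M *m g y0)) ->
  exists2 y, interval_mx c d y & g y = 0.
Proof.
move=> IM0 uIM y0Y gI gN; have [M0 M0P] := IM0.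
have cd : interval_mx c d !=set0 by exists y0.
have extI := box_extension_increments cd M0P gI.
have [y y_zero] := interval_increments_zero IM0 uIM extI.
have [M MP] := extI y y0 I I; rewrite y_zero box_extensionE // sub0r => yM.
have yY : interval_mx c d y.
  have -> : y = y0 - invmx M *m g y0; last exact: gN.
  by rewrite -mulmxN yM mulKmx ?uIM // addrC subrK.
by exists y => //; rewrite -y_zero box_extensionE.
Qed.

Variables (m k : nat) (F : 'cV[R]_m -> 'cV[R]_k).

(** Each row has its own intermediate point [xi i], in the box by convexity. The matrix assembled
    from these rows need not be a derivative, but it satisfies the entrywise bounds. *)
Lemma MVT_interval l (p : 'cV[R]_m) (A : 'M[R]_(m, l)) (c d : 'cV[R]_l)
    (lo hi : 'M[R]_(k, l)) :
  (forall u, differentiable F u) ->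
  (forall y, interval_mx c d y -> interval_mx lo hi (Dmx F (p + A *m y) *m A)) ->
  forall y z, interval_mx c d y -> interval_mx c d z ->
  exists2 M, interval_mx lo hi M &
    F (p + A *m y) - F (p + A *m z) = M *m (y - z).
Proof.
move=> dF DFA y z yP zP.
have [t tP] := choice (fun i => let: ex_intro2 s s01 E :=
    MVT_row (p + A *m z) (A *m (y - z)) i dF in
  ex_intro (fun s : R => 0 <= s <= 1 /\ (F (p + A *m z + A *m (y - z))
      - F (p + A *m z)) i 0 =
    (Dmx F (p + A *m z + s *: (A *m (y - z))) *m (A *m (y - z))) i 0)
  s (conj s01 E)).
pose xi i := z + t i *: (y - z).
exists (\matrix_(i, j) (Dmx F (p + A *m xi i) *m A) i j).
  move=> i j; rewrite mxE; apply: DFA => a b.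
  have [/andP[t0 t1] _] := tP i; have /andP[? ?] := yP a b.
  by have /andP[? ?] := zP a b; rewrite !mxE; apply/andP; split; nra.
have -> : p + A *m y = p + A *m z + A *m (y - z).
  by rewrite -addrA -mulmxDr (addrC z) subrK.
apply/colP => i; have [_ ->] := tP i.
rewrite -addrA scalemxAr -mulmxDr -/(xi i) mulmxA !mxE.
by apply: eq_bigr => j _; rewrite [in RHS]mxE.
Qed.

Variables (n : nat) (p : 'cV[R]_m) (A1 : 'M[R]_(m, n)) (A2 : 'M[R]_(m, k)).

(** By continuity of [Dmx F] and compactness of [X] times [Y], one radius keeps the variation of
    every entry below [e]. *)
Lemma uniform_Dmx_enclosure (X : set 'cV[R]_n) (Y : set 'cV[R]_k)
    (lo hi : 'M[R]_k) (e : R) :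
  Cn_on 1 setT F -> compact X -> compact Y -> 0 < e ->
  (forall x y, X x -> Y y ->
    interval_mx lo hi (Dmx F (p + A1 *m x + A2 *m y) *m A2)) ->
  exists2 r : R, 0 < r & forall x1 x y1 y, X x1 -> Y y1 ->
    `|x1 - x| < r -> `|y1 - y| < r ->
    interval_mx (lo - const_mx e) (hi + const_mx e)
      (Dmx F (p + A1 *m x + A2 *m y) *m A2).
Proof.
move=> cF cX cY e0 DFI.
pose arg (z : 'cV[R]_n * 'cV[R]_k) : 'cV[R]_m := p + A1 *m z.1 + A2 *m z.2.
have carg : continuous arg.
  have c1 : Cn_on 0 setT (@fst 'cV[R]_n 'cV[R]_k) by move=> z _; exact: cvg_fst.
  have c2 : Cn_on 0 setT (@snd 'cV[R]_n 'cV[R]_k) by move=> z _; exact: cvg_snd.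
  have ca : Cn_on 0 setT arg.
    exact: (Cn_onD openT (Cn_onD openT (Cn_on_cst 0 setT p)
      (Cn_on_mulmx openT (Cn_on_cst 0 setT A1) c1))
      (Cn_on_mulmx openT (Cn_on_cst 0 setT A2) c2)).
  by move=> z; exact: ca.
have cDF : continuous (fun u => Dmx F u *m A2).
  have cDA := Cn_on_mulmx openT (Cn_on_Dmx openT cF) (Cn_on_cst 0 setT A2).
  by move=> u; exact: cDA.
have cPsi : continuous (fun z => Dmx F (arg z) *m A2).
  by move=> z; exact: (continuous_comp (carg z) (cDF _)).
have [z [Xz Yz]|r r0 rP] := compact_uniform_ball (compact_setX cX cY)
  (O := fun z => interval_mx (lo - const_mx e) (hi + const_mx e)
      (Dmx F (arg z) *m A2)).
  have nz : \forall w \near z, `|Dmx F (arg z) *m A2 - Dmx F (arg w) *m A2| < e.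
    exact: (cvgrPdist_lt (F := nbhs z) _ _).1 (cPsi z) e e0.
  apply: filterS nz => w zw i j.
  have := le_lt_trans (mx_norm_ler _ i j) zw; have := DFI _ _ Xz Yz i j.
  rewrite -/(arg z); move: (Dmx F (arg z) *m A2) (Dmx F (arg w) *m A2) => Mz Mw.
  by rewrite !mxE ltr_norml => /andP[? ?] /andP[? ?]; apply/andP; split; lra.
exists r => // x1 x y1 y Xx1 Yy1 x1x y1y; apply: (rP (x1, y1) (x, y)) => //.
by rewrite prod_normE /= gt_max x1x y1y.
Qed.

End IntervalNewton.

(** * The implicit zero over the box and its smoothness *)

Theorem theorem4p6 (R : realType) (m k : nat) (hk : (1 <= k)%N) (hm : (k < m)%N)
    (F : 'cV[R]_m -> 'cV[R]_k) (hF : class_on (Some 1%N) [set: 'cV[R]_m] F)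
    (pstar : 'cV[R]_m) (hp : F pstar = 0)
    (A1 : 'M[R]_(m, m - k)) (A2 : 'M[R]_(m, k))
    (a b : 'cV[R]_(m - k)) (c d : 'cV[R]_k)
    (x0 : 'cV[R]_(m - k)) (y0 : 'cV[R]_k) :
  let X := interval_mx a b in
  let Y := interval_mx c d in
  X x0 -> Y y0 ->
  let F_x0y0 := F (pstar + A1 *m x0 + A2 *m y0) in
  let DF_Xy0 := Dmx F @` [set pstar + A1 *m x + A2 *m y0 | x in X] in
  let DF_XY := Dmx F @` [set pstar + A1 *m x + A2 *m y | x in X & y in Y] in
  forall (* the interval enclosures used to evaluate N:
            DXYA2 = [DF_XY A2], DXy0A1 = [DF_Xy0 A1], Xx0 = [X - x0],
            P = DXy0A1 Xx0 and Q = DXYA2^-1 (F_x0y0 + P) *)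
    (DXYA2 : set 'M[R]_(k, k)) (DXy0A1 : set 'M[R]_(k, m - k))
    (Xx0 : set 'cV[R]_(m - k)) (P Q : set 'cV[R]_k),
  interval_enclosure [set M *m A2 | M in DF_XY] DXYA2 ->
  interval_enclosure [set M *m A1 | M in DF_Xy0] DXy0A1 ->
  interval_enclosure [set x - x0 | x in X] Xx0 ->
  interval_enclosure [set M *m u | M in DXy0A1 & u in Xx0] P ->
  (forall M, DXYA2 M -> M \in unitmx) ->
  interval_enclosure
    [set invmx M *m u | M in DXYA2 & u in [set F_x0y0 + w | w in P]] Q ->
  let N := [set y0 - z | z in Q] in
  N `<=` Y ->
  exists q : 'cV[R]_(m - k) -> 'cV[R]_k,
    [/\ forall x, X x -> Y (q x),
        forall x, X x -> F (pstar + A1 *m x + A2 *m q x) = 0 &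
        forall r : option nat, r <> Some 0%N ->
          class_on r [set: 'cV[R]_m] F -> class_on_closed r X q].
Proof.
move=> X Y Xx Yy F00 DF1 DF2 IM IM1 Xx0 P Q [DF2M [lo [hi IME]]]
  [DF1M [lo1 [hi1 IM1E]]] [XX0 _] [MP _] uIM [MQ _] N NY.
rewrite {}IME in DF2M uIM MQ *; rewrite {}IM1E in DF1M MP *.
have dF u : differentiable F u by case: hF => + _; apply.
pose G x y := F (pstar + A1 *m x + A2 *m y).
have DFXY x y : X x -> Y y ->
    interval_mx lo hi (Dmx F (pstar + A1 *m x + A2 *m y) *m A2).
  move=> xX yY; apply: DF2M; exists (Dmx F (pstar + A1 *m x + A2 *m y)) => //.
  by exists (pstar + A1 *m x + A2 *m y) => //; exists x => //; exists y.
have IM0 : interval_mx lo hi !=set0.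
  by exists (Dmx F (pstar + A1 *m x0 + A2 *m y0) *m A2); exact: DFXY.
have zeroX x : X x -> exists2 y, Y y & G x y = 0.
  move=> xX; apply: (interval_newton_zero (lo := lo) (hi := hi) (y0 := y0)) => //.
    by move=> y z yY zY; apply: (MVT_interval dF) yY zY => w; exact: DFXY.
  move=> M MI; apply: NY; exists (invmx M *m G x y0) => //.
  apply: MQ; exists M; first exact: MI.
  exists (G x y0); last by [].
  (* With [y0] fixed, the mean value form in [x] shows that [G x y0] lies in [F_x0y0 + P], so the
     Newton images for this [x] lie in [N]. *)
  have [M1 M1I E] : exists2 M1, interval_mx lo1 hi1 M1 &
      F (pstar + A2 *m y0 + A1 *m x) - F (pstar + A2 *m y0 + A1 *m x0) =
      M1 *m (x - x0).
    apply: (MVT_interval dF) xX Xx => y yX; apply: DF1M.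
    exists (Dmx F (pstar + A1 *m y + A2 *m y0)); last by rewrite addrAC.
    by exists (pstar + A1 *m y + A2 *m y0) => //; exists y.
  exists (M1 *m (x - x0)).
    by apply: MP; exists M1 => //; exists (x - x0) => //; apply: XX0; exists x.
  rewrite -E /F00 /G (addrAC _ (A2 *m y0)) (addrAC _ (A2 *m y0)).
  by rewrite addrCA subrr addr0.
have [e e0 uIMe] := unit_interval_mx_fatten IM0 uIM.
have [r r0 rP] := uniform_Dmx_enclosure (A1 := A1) hF
  (@interval_mx_compact _ _ _ a b) (@interval_mx_compact _ _ _ c d) e0 DFXY.
pose lo' := lo - const_mx e; pose hi' := hi + const_mx e.
(* Points of the enlarged box are within [s] of [Y], which is strictly less than the [r] of [rP]. *)
pose s := r / 2; have s0 : 0 < s by rewrite divr_gt0.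
pose c' := c - const_mx s; pose d' := d + const_mx s.
have YY' y y1 : Y y1 -> `|y1 - y| <= s -> interval_mx c' d' y.
  move=> y1Y y1y i j; have := le_trans (mx_norm_ler _ i j) y1y.
  have := y1Y i j; rewrite !mxE ler_norml => /andP[? ?] /andP[? ?].
  by apply/andP; split; lra.
have subY' y : Y y -> interval_mx c' d' y.
  by move=> yY; apply: YY' yY _; rewrite subrr normr0 ltW.
have Y0 : Y !=set0 by exists y0.
have Y'0 : interval_mx c' d' !=set0 by exists y0; exact: subY'.
have IMe0 : interval_mx lo' hi' !=set0.
  case: IM0 => M4 MI; exists M4 => i j; have /andP[? ?] := MI i j.
  by rewrite !mxE; apply/andP; split; lra.
have [M0 M0P] := IMe0.
have [C C0 HC] := unit_interval_mx_expand uIMe.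
pose U0 : set 'cV[R]_(m - k) := \bigcup_(x1 in X) ball x1 r.
have oU0 : open U0 by apply: bigcup_open => x1 _; exact: ball_open.
have DFU0 x y : U0 x -> interval_mx c' d' y ->
    interval_mx lo' hi' (Dmx F (pstar + A1 *m x + A2 *m y) *m A2).
  move=> [x1 x1X]; rewrite -ball_normE /= => x1x yY'.
  have [y1 y1Y y1y] := clamp_interval_mx (ltW s0) Y0 yY'.
  apply: rP x1X y1Y x1x _; apply: le_lt_trans y1y _; rewrite /s; lra.
pose ext x := box_extension c' d' M0 (G x).
have extI x : U0 x -> interval_increments lo' hi' (ext x) setT.
  move=> xU0; apply: box_extension_increments => // y z yY zY.
  by apply: (MVT_interval dF) yY zY => w; exact: DFU0.
have extC x y z : U0 x -> `|y - z| <= C * `|ext x y - ext x z|.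
  by move=> /extI /(_ y z I I) [M MI ->]; exact: HC.
(* For [x] in [U0] outside [X] the zero may leave the enlarged box, so [q] is taken from the zeros
   of the extension; 0 is a default outside [U0]. *)
have /choice[q q0] : forall x, exists y, U0 x -> ext x y = 0.
  move=> x; have [xU0|] := pselect (U0 x); last by exists 0.
  by have [y] := interval_increments_zero IMe0 uIMe (extI x xU0); exists y.
have XU0 x : X x -> U0 x by move=> xX; exists x => //; exact: ballxx.
have qX x : X x -> Y (q x).
  (* By [extC] the zero of [ext x] is unique, so it is the one found in [Y]. *)
  move=> xX; have [y yY Gy] := zeroX x xX.
  suff -> : q x = y by [].
  have xU0 := XU0 x xX; have yY' := subY' y yY.
  apply/eqP; rewrite -subr_eq0 -normr_le0 (le_trans (extC x _ _ xU0)) //.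
  by rewrite q0 // /ext box_extensionE // Gy subrr normr0 mulr0.
have cq x : U0 x -> {for x, continuous q}.
  move=> xU0; apply: (cvgrPdist_lt (F := nbhs x) q (q x)).2 => e1 e10.
  (* By [extC], [|q x - q z|] is at most [C] times the difference of [ext z] and [ext x] at [q x].
     The slope terms cancel, leaving [G z y - G x y]. *)
  pose y := clamp c' d' (q x).
  have cG : {for x, continuous (fun z => G z y)}.
    have cz : {for x, continuous (fun z => pstar + A1 *m z + A2 *m y)}.
      apply: continuousD; last exact: cst_continuous.
      apply: continuousD; first exact: cst_continuous.
      exact: mulmx_continuous.
    exact: (continuous_comp cz (differentiable_continuous (dF _))).
  have nU0 : \forall z \near x, U0 z by exact: open_nbhs_nbhs.
  have nG : \forall z \near x, `|G x y - G z y| < e1 / C.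
    exact: (cvgrPdist_lt (F := nbhs x) _ _).1 cG (e1 / C) (divr_gt0 e10 C0).
  apply: filterS2 nU0 nG => z zU0.
  rewrite ltr_pdivlMr // mulrC; apply: le_lt_trans.
  rewrite (le_trans (extC z _ _ zU0)) // ler_wpM2l ?(ltW C0) //.
  rewrite (q0 z) // subr0 -(subr0 (ext z _)) -(q0 x xU0) distrC.
  by rewrite /ext /box_extension opprD addrACA subrr addr0.
pose O : set 'cV[R]_k := \bigcup_(y1 in Y) ball y1 s.
have oO : open O by apply: bigcup_open => y1 _; exact: ball_open.
have OY' y : O y -> interval_mx c' d' y.
  by move=> [y1 y1Y]; rewrite -ball_normE /= => /ltW; exact: YY'.
(* On [U] the value [q x] lies in the enlarged box, where the extension agrees with [G x], so [q]
   solves the original equation. *)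
pose U := U0 `&` q @^-1` O.
have oU : open U.
  rewrite openE => x [xU0 xO]; apply: filterI; first exact: open_nbhs_nbhs.
  by apply: cq => //; exact: open_nbhs_nbhs.
have FU x : U x -> F (pstar + A1 *m x + A2 *m q x) = 0.
  by move=> [xU0 /OY' xO]; have := q0 x xU0; rewrite /ext box_extensionE.
have XU : X `<=` U.
  move=> x xX; split; first exact: XU0.
  by exists (q x); [exact: qX | exact: ballxx].
have uU x : U x -> Dmx F (pstar + A1 *m x + A2 *m q x) *m A2 \in unitmx.
  by move=> [xU0 /OY' xO]; apply: uIMe; exact: DFU0.
have qC i : Cn_on i.+1 setT F -> Cn_on i.+1 U q.
  by apply: (implicit_Cn_on (p := pstar) (A1 := A1) (A2 := A2)) => // x [] /cq.
exists q; split => // [x xX|[[|i]|] // _ cF]; first by apply: FU; exact: XU.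
  by exists U, q; split => //; exact: qC.
(* The same [U] and [q] serve all finite orders; order [i] is read off from order [i.+1], as [qC]
   starts at order 1. *)
by exists U, q; split => // i; exact: Cn_onW (qC i (cF i.+1)).
Qed.
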